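(* Let $G$ be an unweighted undirected graph with $n$ vertices, let $s\in V(G)$, let $\alpha\ge 1$, $\beta\ge 0$, and let $S$ be an $(\alpha,\beta)$-spanner of $G$ with $\sigma$ edges. Then, given $G$, $s$ and $S$, one can compute in polynomial time an $(\alpha,\beta)$-EABFS of $G$ with respect to $s$ having at most $\sigma+3n$ edges.
   Context: Distances $d_X(x,y)$ in an unweighted graph $X$ are numbers of edges on a shortest $x$–$y$ path ($+\infty$ if none). For an edge $e$, $X-e$ denotes $X$ with $e$ removed. An $(\alpha,\beta)$-spanner of $G$ is a spanning subgraph $S$ of $G$ such that $d_S(x,y)\le \alpha\, d_G(x,y)+\beta$ for all $x,y\in V(G)$. An $(\alpha,\beta)$-EABFS (edge-fault-tolerant $(\alpha,\beta)$-approximate BFS structure) of $G$ with respect to $s$ is a spanning subgraph $H$ of $G$ such that for every edge $e\in E(G)$ and every $t\in V(G)$, $d_{H-e}(s,t)\le \alpha\, d_{G-e}(s,t)+\beta$. *)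

(* Defs.v *)
From mathcomp Require Import all_boot all_order all_algebra.
From mathcomp Require Import boolp reals constructive_ereal.

Set Implicit Arguments.
Unset Strict Implicit.
Unset Printing Implicit Defensive.

Import Order.TTheory GRing.Theory Num.Theory.

(* A simple undirected graph on the vertex type V is given by its edge set, a *)
(* set of 2-element subsets of V.  Its spanning subgraphs are the subsets of  *)
(* the edge set, its number of edges is #|G|, and removing e is G :\ e.       *)
Section Graphs.
Variable V : finType.
Implicit Types (G S H : {set {set V}}) (x y s : V).

Definition is_graph G : Prop := forall e, e \in G -> #|e| = 2.

Definition spanning_subgraph H G : Prop := H \subset G.

Definition adj G : rel V := fun x y => [set x; y] \in G.

Definition has_path G x y (k : nat) : bool :=
  [exists p : k.-tuple V,
     [&& path (adj G) x p, last x p == y & uniq (x :: p)]].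

Definition dist (R : realType) G x y : \bar R :=
  match pselect (exists k, has_path G x y k) with
  | left ex_path => ((ex_minn ex_path)%:R%R)%:E
  | right _ => +oo%E
  end.

Definition spanner (R : realType) (alpha beta : R) G S : Prop :=
  spanning_subgraph S G /\
  forall x y, (dist R S x y <= alpha%:E * dist R G x y + beta%:E)%E.

Definition EABFS (R : realType) (alpha beta : R) G s H : Prop :=
  spanning_subgraph H G /\
  forall e, e \in G -> forall t,
    (dist R (H :\ e) s t <= alpha%:E * dist R (G :\ e) s t + beta%:E)%E.

End Graphs.

(* Random-access machines, presented as structured programs.  A state has     *)
(* registers, addressed by literals only, and a memory with indirect          *)
(* addressing; all cells contain natural numbers.  The cost of a run is the   *)
(* number of operations executed.  Addition and (truncated) subtraction are   *)
(* the only arithmetic primitives: with multiplication at unit cost, numbers  *)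
(* of exponential length could be produced in polynomial time, whereas here   *)
(* polynomial time agrees with polynomial time on Turing machines.            *)
Inductive expr : Type :=
| Cst of nat
| Reg of nat
| Cell of expr
| Add of expr & expr
| Sub of expr & expr.

Inductive prog : Type :=
| Skip
| Assign of nat & expr
| Store of expr & expr
| Seq of prog & prog
| If of expr & prog & prog
| While of expr & prog.

Record state : Type := State { regs : nat -> nat; mem : nat -> nat }.

Fixpoint eval (st : state) (a : expr) : nat :=
  match a with
  | Cst k => k
  | Reg r => regs st r
  | Cell a1 => mem st (eval st a1)
  | Add a1 a2 => eval st a1 + eval st a2
  | Sub a1 a2 => eval st a1 - eval st a2
  end.

Fixpoint ecost (a : expr) : nat :=
  match a with
  | Cst _ | Reg _ => 1
  | Cell a1 => (ecost a1).+1
  | Add a1 a2 | Sub a1 a2 => (ecost a1 + ecost a2).+1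
  end.

Definition set_reg (st : state) (r v : nat) : state :=
  State [eta regs st with r |-> v] (mem st).

Definition set_mem (st : state) (a v : nat) : state :=
  State (regs st) [eta mem st with a |-> v].

(* exec c st t st': started in st, c halts in st' after t operations; a test  *)
(* succeeds when its value is nonzero.                                        *)
Inductive exec : prog -> state -> nat -> state -> Prop :=
| ExecSkip st :
    exec Skip st 1 st
| ExecAssign r a st :
    exec (Assign r a) st (ecost a).+1 (set_reg st r (eval st a))
| ExecStore a b st :
    exec (Store a b) st (ecost a + ecost b).+1
         (set_mem st (eval st a) (eval st b))
| ExecSeq c1 c2 st st1 st2 t1 t2 :
    exec c1 st t1 st1 -> exec c2 st1 t2 st2 ->
    exec (Seq c1 c2) st (t1 + t2) st2
| ExecIfTrue a c1 c2 st st1 t :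
    eval st a != 0 -> exec c1 st t st1 ->
    exec (If a c1 c2) st (ecost a + t).+1 st1
| ExecIfFalse a c1 c2 st st1 t :
    eval st a = 0 -> exec c2 st t st1 ->
    exec (If a c1 c2) st (ecost a + t).+1 st1
| ExecWhileTrue a c st st1 st2 t1 t2 :
    eval st a != 0 -> exec c st t1 st1 -> exec (While a c) st1 t2 st2 ->
    exec (While a c) st (ecost a + t1 + t2).+1 st2
| ExecWhileFalse a c st :
    eval st a = 0 ->
    exec (While a c) st (ecost a).+1 st.

(* A program has at most one run from a given state, so that an existential   *)
(* statement about exec is a statement about the run.                         *)
Lemma exec_det c st t1 st1 t2 st2 :
  exec c st t1 st1 -> exec c st t2 st2 -> t1 = t2 /\ st1 = st2.
Proof.
move=> E1; elim: E1 t2 st2 => {c st t1 st1}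
  [st|r a st|a b st|c1 c2 st st1 st2 t1 t2 _ IH1 _ IH2
  |a c1 c2 st st1 t nz _ IH|a c1 c2 st st1 t z _ IH
  |a c st st1 st2 t1 t2 nz _ IH1 _ IH2|a c st z] u stu E; inversion E; subst.
all: try by split.
all: try by move: nz; match goal with H : eval _ _ = 0 |- _ => rewrite H end.
all: try by match goal with H : is_true (eval _ _ != 0) |- _ =>
       move: H; rewrite z end.
all: repeat match goal with
  | IH : forall t st, exec ?c ?s t st -> _, E : exec ?c ?s _ _ |- _ =>
      case: (IH _ _ E) => ? ?; subst; clear IH
  end; by split.
Qed.

Definition adj_seq (n : nat) (G : {set {set 'I_n}}) : seq nat :=
  [seq (adj G i j : nat) | i <- enum 'I_n, j <- enum 'I_n].

(* The size of the input is 2 + 2 * n ^ 2 numbers, none of them above n, so   *)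
(* that polynomial in n means polynomial in the size of the input.            *)
Definition input_state (n : nat) (G : {set {set 'I_n}}) (s : 'I_n)
    (S : {set {set 'I_n}}) : state :=
  State (nth 0 [:: n; nat_of_ord s]) (nth 0 (adj_seq G ++ adj_seq S)).

Definition outputs (n : nat) (st : state) (H : {set {set 'I_n}}) : Prop :=
  mkseq (mem st) (n * n) = adj_seq H.

(* Main.v *)
(* H is S together with a breadth-first search tree T and, for each tree edge   *)
(* e = (p v, v), one swap edge (x', y') re-entering the subtree T_v from         *)
(* outside, with depth x' + depth y' minimal: at most sigma + 2n edges.          *)
(* Only the failure of such an e with t in T_v is interesting.  A shortest       *)
(* s-t path of G - e enters T_v by some edge (x, y), so its length is at least   *)
(* depth x + d_G(x, t).  Let Q be a shortest x-t path of S.  If Q avoids e,      *)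
(* follow T from s to x and then Q.  If Q uses e then |Q| is at least            *)
(* depth x + depth t - 2 depth v + 2; on the other hand the walk through T from  *)
(* s to x', then (x', y'), then through T from y' up to v and down to t has      *)
(* length depth x' + depth y' + depth t - 2 depth v + 1, which is at most        *)
(* depth x + |Q| because depth x' + depth y' <= depth x + depth y <= 2 depth x + 1. *)

(* When a tree edge e = (p v, v) fails, the search tree T still gives a shortest path from s to each
   reachable vertex outside T_v ([root_walk_outside]), so only targets t in T_v matter. Any
   replacement path enters T_v by some crossing edge (x, y). From x onwards the spanner is followed.
   Either its path avoids e, or it travels up to e and down again and is then so long that the
   detour over the cheapest crossing edge costs no more. [swap_walk] makes this comparison, using
   that depth grows by at most 1 along an edge ([dep_walk]). The stretch is paid only on the part
   after x. [swap_EABFS] adds the failures that leave the tree path to t intact.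

   For the algorithm, programs are restricted to counted loops, so that termination and a polynomial
   bound are read off the syntax ([compile_exec]), and correctness is proved by loop invariants on
   [run]. A search of n rounds yields T ([run_bfs], [bfs_inv_tree]), membership in T_v is decided by
   climbing n parent links ([desc_subtrees]), and each v then contributes at most its parent edge
   and one minimal crossing edge ([run_augment]), at most 2n edges in all. *)
Require Import Defs.
From mathcomp Require Import all_boot all_order all_algebra.
From mathcomp Require Import boolp reals constructive_ereal.
From mathcomp Require Import zify.

Set Implicit Arguments.
Unset Strict Implicit.
Unset Printing Implicit Defensive.

Import Order.TTheory GRing.Theory Num.Theory.

(** * Programs whose loops run from 0 to n - 1 *)

(* Register 0 holds n.  Such programs always halt, so they have a denotational   *)
(* semantics [run] and a syntactic polynomial time bound. *)
Inductive loop_prog : Type :=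
| LAssign of nat & expr
| LStore of expr & expr
| LSeq of loop_prog & loop_prog
| LWhen of expr & loop_prog
| LFor of nat & loop_prog.

Fixpoint compile (c : loop_prog) : prog :=
  match c with
  | LAssign r a => Assign r a
  | LStore a b => Store a b
  | LSeq c1 c2 => Seq (compile c1) (compile c2)
  | LWhen a c1 => If a (compile c1) Skip
  | LFor r c1 => Seq (Assign r (Cst 0))
      (While (Defs.Sub (Reg 0) (Reg r))
         (Seq (compile c1) (Assign r (Add (Reg r) (Cst 1)))))
  end.

Fixpoint run (c : loop_prog) (st : state) : state :=
  match c with
  | LAssign r a => set_reg st r (eval st a)
  | LStore a b => set_mem st (eval st a) (eval st b)
  | LSeq c1 c2 => run c2 (run c1 st)
  | LWhen a c1 => if eval st a != 0 then run c1 st else st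
  | LFor r c1 =>
      iter (regs st 0) (fun st1 => let st2 := run c1 st1 in
                          set_reg st2 r (regs st2 r + 1)) (set_reg st r 0)
  end.

Fixpoint writes (c : loop_prog) : seq nat :=
  match c with
  | LAssign r _ => [:: r]
  | LStore _ _ => [::]
  | LSeq c1 c2 => writes c1 ++ writes c2
  | LWhen _ c1 => writes c1
  | LFor r c1 => r :: writes c1
  end.

(* No loop body writes its own counter. *)
Fixpoint counters_ok (c : loop_prog) : bool :=
  match c with
  | LAssign _ _ | LStore _ _ => true
  | LSeq c1 c2 => counters_ok c1 && counters_ok c2
  | LWhen _ c1 => counters_ok c1
  | LFor r c1 => (r \notin writes c1) && counters_ok c1
  end.

Fixpoint stores (c : loop_prog) : bool :=
  match c with
  | LAssign _ _ => false
  | LStore _ _ => true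
  | LSeq c1 c2 => stores c1 || stores c2
  | LWhen _ c1 | LFor _ c1 => stores c1
  end.

(** In a loop, 8 per iteration pays for the test (4) and the increment (4), and the final 6 for the
    initialisation (2) and the failing test (4). For [LWhen], the bound also covers the cost of
    [Skip]. *)
Fixpoint time (c : loop_prog) : {poly nat} :=
  match c with
  | LAssign _ a => ((ecost a).+1)%:P%R
  | LStore a b => ((ecost a + ecost b).+1)%:P%R
  | LSeq c1 c2 => (time c1 + time c2)%R
  | LWhen a c1 => (time c1 + ((ecost a).+2)%:P)%R
  | LFor _ c1 => ((time c1 + 8%:P) * 'X + 6%:P)%R
  end.

Lemma regs_run c st q : q \notin writes c -> regs (run c st) q = regs st q.
Proof.
elim: c st => [r a|a b|c1 IH1 c2 IH2|a c1 IH|r c1 IH] st //=.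
- by rewrite inE => /negbTE ->.
- by rewrite mem_cat negb_or => /andP[q1 q2]; rewrite IH2 // IH1.
- by move=> qw; case: ifP => // _; rewrite IH.
- rewrite inE negb_or => /andP[/negbTE qr qw].
  by elim: (regs st 0) => [|m IHm] /=; rewrite qr // IH.
Qed.

Lemma mem_run c st : ~~ stores c -> Defs.mem (run c st) = Defs.mem st.
Proof.
elim: c st => [r a|a b|c1 IH1 c2 IH2|a c1 IH|r c1 IH] st //=.
- by rewrite negb_or => /andP[q1 q2]; rewrite IH2 // IH1.
- by move=> qw; case: ifP => // _; rewrite IH.
- by move=> ns; elim: (regs st 0) => [|m IHm] //=; rewrite IH.
Qed.

Lemma compile_exec c st : counters_ok c -> 0 \notin writes c ->
  exists2 t, exec (compile c) st t (run c st) & t <= ((time c).[regs st 0])%R.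
Proof.
elim: c st => [r a|a b|c1 IH1 c2 IH2|a c1 IH|r c1 IH] st /=.
- by move=> _ _; eexists; [exact: ExecAssign|rewrite hornerC].
- by move=> _ _; eexists; [exact: ExecStore|rewrite hornerC].
- move=> /andP[ok1 ok2]; rewrite mem_cat negb_or => /andP[w1 w2].
  have [t1 E1 le1] := IH1 st ok1 w1; have [t2 E2 le2] := IH2 (run c1 st) ok2 w2.
  exists (t1 + t2); first exact: ExecSeq E1 E2.
  by rewrite hornerD leq_add // -(regs_run st w1).
- move=> ok1 w1; have [t E le_t] := IH st ok1 w1.
  case: (eqVneq (eval st a) 0) => [z|nz] /=.
    exists (ecost a + 1).+1; first exact: ExecIfFalse z (ExecSkip _).
    by rewrite hornerD hornerC addn1 leq_addl.
  exists (ecost a + t).+1; first exact: ExecIfTrue nz E.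
  rewrite hornerD hornerC; move: le_t; lia.
- move=> /andP[rw ok1]; rewrite inE negb_or => /andP[r0 w1].
  pose f st2 := set_reg (run c1 st2) r (regs (run c1 st2) r + 1).
  rewrite -/f; set n := regs st 0; set T := ((time c1).[n])%R.
  (* [m] counts the iterations still to come, which allows induction although the body changes the
     state. *)
  have loop m st1 : regs st1 0 = n -> regs st1 r + m = n ->
    exists2 t, exec (While (Defs.Sub (Reg 0) (Reg r))
         (Seq (compile c1) (Assign r (Add (Reg r) (Cst 1))))) st1 t (iter m f st1)
      & t <= (T + 8) * m + 4.
    elim: m st1 => [|m IHm] st1 e0 er.
      exists 4; last by rewrite muln0.
      by apply: ExecWhileFalse => /=; rewrite e0 -er addn0 subnn.
    have [t E le_t] := IH st1 ok1 w1.
    have [|/= |t2 E2 le2] := IHm (f st1).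
    - by rewrite /= (negbTE r0) regs_run.
    - by rewrite eqxx regs_run // -addnA.
    rewrite -iterSr in E2; exists (3 + (t + 4) + t2).+1.
      apply: ExecWhileTrue E2; first by rewrite /= e0 subn_eq0 -er -ltnNge; lia.
      apply: ExecSeq E _.
      exact: (ExecAssign r (Add (Reg r) (Cst 1)) (run c1 st1)).
    by move: le_t le2; rewrite e0 -/T; lia.
  have [|/= |t E le_t] := loop n (set_reg st r 0).
  - by rewrite /= (negbTE r0).
  - by rewrite eqxx.
  exists (2 + t); first exact: (ExecSeq (ExecAssign r (Cst 0) st)).
  rewrite hornerD hornerMX hornerD !hornerC -/n -/T; move: le_t.
  rewrite /GRing.add /GRing.mul /=; lia.
Qed.

(** The invariant rule for counted loops. The frame premise, that registers the loop does not write
    keep their initial values, is supplied here so that invariants need not repeat it. *)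
Lemma run_for_ind (I : nat -> state -> Prop) r c st :
  counters_ok (LFor r c) -> 0 \notin writes (LFor r c) ->
  I 0 (set_reg st r 0) ->
  (forall k st1, k < regs st 0 -> regs st1 r = k ->
     (forall q, q \notin writes (LFor r c) -> regs st1 q = regs st q) ->
     I k st1 -> I k.+1 (set_reg (run c st1) r k.+1)) ->
  I (regs st 0) (run (LFor r c) st).
Proof.
move=> /= /andP[rw _]; rewrite inE negb_or => /andP[r0 w0] I0 IS.
set f := (fun st1 => _).
suff H : forall m, m <= regs st 0 ->
  [/\ I m (iter m f (set_reg st r 0)), regs (iter m f (set_reg st r 0)) r = m
    & forall q, q \notin r :: writes c ->
        regs (iter m f (set_reg st r 0)) q = regs st q].
  by case: (H _ (leqnn _)).
elim=> [|m IHm] lem.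
  split=> //=; first by rewrite eqxx.
  by move=> q; rewrite inE negb_or => /andP[/negbTE ->].
have [Im rm qm] := IHm (ltnW lem); split=> //=.
- by rewrite /f regs_run // rm addn1; apply: IS.
- by rewrite /f /= eqxx regs_run // rm addn1.
- move=> q qw; have /norP[/negbTE qr qc]: ~~ ((q == r) || (q \in writes c)) by [].
  by rewrite /f /= qr regs_run // qm.
Qed.

(** * Swap edges *)

Lemma eq_set2 (T : finType) (x y u v : T) :
  ([set x; y] == [set u; v]) =
  (x == u) && (y == v) || (x == v) && (y == u).
Proof.
apply/eqP/idP; last by case/orP=> /andP[/eqP-> /eqP->] //; rewrite setUC.
move=> E; have := set21 x y; have := set22 x y; rewrite E !inE.
have := set21 u v; have := set22 u v; rewrite -E !inE.
rewrite ![u == _]eq_sym ![v == _]eq_sym.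
by case: (x == u) (x == v) (y == u) (y == v) => [] [] [] [].
Qed.

Lemma path_crossing (T : eqType) (e : rel T) (a : pred T) x p :
    path e x p -> ~~ a x -> a (last x p) ->
  exists p1 y p2, [/\ p = p1 ++ y :: p2, ~~ a (last x p1) & a y].
Proof.
elim: p x => [|y p IHp] x /=; first by move=> _ /negbTE ->.
move=> /andP[_ yp] nax; case: (boolP (a y)) => [ay _|nay].
  by exists [::], y, p.
by move=> /(IHp y yp nay)[p1 [z [p2 [-> nl az]]]]; exists (y :: p1), z, p2.
Qed.

(** * Walks and their relation to distances *)

Section Walks.
Variable V : finType.
Implicit Types (G H S : {set {set V}}) (x y z : V).

Lemma adjC G x y : adj G x y = adj G y x.
Proof. by rewrite /adj setUC. Qed.

Lemma adjD1 G e x y : adj (G :\ e) x y = ([set x; y] != e) && adj G x y.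
Proof. by rewrite /adj !inE. Qed.

(** Vertices may repeat, unlike in [has_path], so that walks concatenate freely; shortening in
    [dist_le_walk] leads back to distances. *)
Definition walk G x y k :=
  exists p, [/\ path (adj G) x p, last x p = y & size p = k].

Lemma walk0 G x : walk G x x 0.
Proof. by exists [::]. Qed.

Lemma walk1 G x y : adj G x y -> walk G x y 1.
Proof. by move=> xy; exists [:: y]; rewrite /= xy. Qed.

Lemma walk_trans G y x z k l : walk G x y k -> walk G y z l -> walk G x z (k + l).
Proof.
move=> [p [pp <- <-]] [q [qq <- <-]]; exists (p ++ q).
by rewrite cat_path pp qq last_cat size_cat.
Qed.

Lemma walk_sym G x y k : walk G x y k -> walk G y x k.
Proof.
move=> [p [pp <- <-]]; exists (rev (belast x p)); split.
- by rewrite rev_path -(eq_path (e := adj G)) // => u v; rewrite adjC.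
- by case: p pp => //= z p _; rewrite rev_cons last_rcons.
- by rewrite size_rev size_belast.
Qed.

Lemma walk_sub G H x y k : G \subset H -> walk G x y k -> walk H x y k.
Proof.
move=> GH [p [pp <- <-]]; exists p; split=> //; apply: sub_path pp => u v.
exact: (subsetP GH).
Qed.

Lemma walk_avoid_or_use G e x y k : walk G x y k ->
  walk (G :\ e) x y k \/
  exists a b i j, [/\ walk G x a i, walk G b y j, e = [set a; b] & k = i + 1 + j].
Proof.
move=> [p [pp <- <-]]; elim: p x pp => [|z p IHp] x /=.
  by left; apply: walk0.
move=> /andP[xz zp]; case: (eqVneq [set x; z] e) => [<-|ne].
  by right; exists x, z, 0, (size p); split=> //; [exact: walk0|exists p].
have xz' : walk G x z 1 by apply: walk1.
case: (IHp z zp) => [w|[a [b [i [j [wa wb -> ->]]]]]].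
  left; rewrite -add1n; apply: walk_trans w; apply: walk1.
  by rewrite adjD1 ne.
by right; exists a, b, (1 + i), j; split=> //; apply: walk_trans wa.
Qed.

Lemma dist_le_walk (R : realType) G x y k :
  walk G x y k -> (dist R G x y <= k%:R%:E)%E.
Proof.
move=> [p [pp <- <-]]; case/shortenP: pp => q qq uq qp.
have le_qp : size q <= size p by apply: uniq_leq_size => //; case/andP: uq.
have hq : has_path G x (last x q) (size q).
  by apply/existsP; exists (in_tuple q); rewrite /= qq eqxx.
rewrite /dist; case: pselect => [ex_p|[]]; last by exists (size q).
case: ex_minnP => m _ /(_ _ hq) le_mq.
by rewrite lee_fin ler_nat (leq_trans le_mq).
Qed.

Lemma dist_walk (R : realType) G x y : dist R G x y = +oo%E \/
  exists2 k, walk G x y k & dist R G x y = k%:R%:E.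
Proof.
rewrite /dist; case: pselect => [ex_p|]; last by left.
right; case: ex_minnP => k /existsP[p /and3P[pp /eqP lp _]] _.
by exists k => //; exists p; rewrite size_tuple.
Qed.

Lemma spanner_walk (R : realType) (alpha beta : R) G S x y k :
    (0 <= alpha)%R -> spanner alpha beta G S -> walk G x y k ->
  exists2 q, walk S x y q & (q%:R <= alpha * k%:R + beta)%R.
Proof.
move=> a0 [_ /(_ x y) le_S] /(dist_le_walk R) le_G.
have {}le_S : (dist R S x y <= (alpha * k%:R + beta)%:E)%E.
  apply: le_trans le_S _; rewrite EFinD leeD2r // EFinM.
  by apply: lee_wpmul2l.
have [Einf|[q wq Eq]] := dist_walk R S x y; first by move: le_S; rewrite Einf.
by exists q => //; move: le_S; rewrite Eq lee_fin.
Qed.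

(** * Surviving one edge failure by means of swap edges *)

Section SwapEdges.
Variables (G H S : {set {set V}}) (s : V).
Variables (dep : V -> nat) (par : V -> V) (desc : V -> pred V).

(* [dep] is 1 + the distance from s, and 0 on unreachable vertices. *)
Definition bfs_tree :=
  [/\ forall x, dep x = 1 <-> x = s,
      forall y, 1 < dep y -> adj G (par y) y /\ dep y = (dep (par y)).+1
    & forall x y, adj G x y -> 0 < dep x -> 0 < dep y <= (dep x).+1].

Definition subtrees :=
  [/\ forall v, desc v v,
      forall v w, desc v w -> w != v -> 1 < dep v -> 1 < dep w /\ desc v (par w)
    & forall v w, 1 < dep w -> desc v (par w) -> desc v w].

(** These are the edges, oriented inwards, by which a walk from s that avoids the parent edge of v
    can enter T_v. *)
Definition crossing v x y :=
  [&& adj G x y, 0 < dep x, ~~ desc v x, desc v y & [set x; y] != [set par v; v]].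

Definition has_best_swap v := forall x y, crossing v x y ->
  exists x' y', [/\ crossing v x' y', adj H x' y' & dep x' + dep y' <= dep x + dep y].

Hypotheses (tree : bfs_tree) (sub : subtrees).
Hypotheses (HG : H \subset G) (SH : S \subset H).
Hypothesis parH : forall y, 1 < dep y -> adj H (par y) y.
Hypothesis swapH : forall v, 1 < dep v -> has_best_swap v.

Lemma dep_walk x y k : walk G x y k -> 0 < dep x -> 0 < dep y <= dep x + k.
Proof.
move=> [p [pp <- <-]]; elim: p x pp => [|z p IHp] x /=.
  by rewrite addn0 leqnn andbT.
have [_ _ edge] := tree.
move=> /andP[/edge xz zp] /xz /andP[z0 zx]; have := IHp z zp z0; lia.
Qed.

(** Parent links are followed from t up to s without leaving [Q]. It serves with [Q] the complement
    of a subtree, and with all vertices when e is not a tree edge. *)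
Lemma root_walk (Q : pred V) e t :
    (forall w, Q w -> 1 < dep w -> Q (par w) /\ [set par w; w] != e) ->
  0 < dep t -> Q t -> walk (H :\ e) s t (dep t).-1.
Proof.
move=> Qpar; have [root par_dep _] := tree.
move dt: (dep t) => m; elim: m t dt => [//|m IHm] t dt _ Qt.
case: m => [|m] in IHm dt *; first by rewrite ((root t).1 dt); apply: walk0.
have t1 : 1 < dep t by rewrite dt.
have [Qp ne] := Qpar _ Qt t1; have [_ dp] := par_dep _ t1.
have {}dp : dep (par t) = m.+1 by lia.
rewrite /= -addn1; apply: walk_trans (IHm _ dp _ Qp) _ => //.
by apply: walk1; rewrite adjD1 ne parH.
Qed.

(** With the opposite orientation v and w would be parents of each other, which their depths
    forbid. *)
Lemma par_edge_inj v w : 1 < dep v -> 1 < dep w ->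
  [set par w; w] = [set par v; v] -> w = v.
Proof.
have [_ par_dep _] := tree => v1 w1 /eqP; rewrite eq_set2.
case/orP=> /andP[/eqP pw /eqP wv] //.
have [_] := par_dep _ v1; have [_] := par_dep _ w1; rewrite pw -wv; lia.
Qed.

Lemma subtree_walk v t : 1 < dep v -> desc v t ->
  exists2 k, walk (H :\ [set par v; v]) v t k & dep v + k = dep t.
Proof.
move=> v1; have [_ par_dep _] := tree; have [_ up _] := sub.
move dt: (dep t) => m; elim: m t dt => [|m IHm] t dt vt;
  (case: (eqVneq t v) => [etv|tv];
    first by exists 0; [rewrite etv; exact: walk0|rewrite -etv dt addn0]);
  have [t1 vpt] := up _ _ vt tv v1; first by rewrite dt in t1.
have [_ dp] := par_dep _ t1; have {}dp : dep (par t) = m by lia.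
have [k wk ek] := IHm _ dp vpt.
exists (k + 1); last by lia.
apply: walk_trans wk (walk1 _); rewrite adjD1 parH // andbT.
by apply: contraNneq tv => /par_edge_inj ->.
Qed.

Lemma root_walk_outside v t : 1 < dep v -> 0 < dep t -> ~~ desc v t ->
  walk (H :\ [set par v; v]) s t (dep t).-1.
Proof.
move=> v1 t0 nvt; have [refl _ down] := sub.
apply: (root_walk (Q := [pred w | ~~ desc v w])) => //= w nvw w1; split.
  exact: contra (down _ _ w1) nvw.
by apply: contraNneq nvw => /par_edge_inj ->.
Qed.

Lemma swap_walk (R : realType) (alpha beta : R) v t k :
    (1 <= alpha)%R -> spanner alpha beta G S ->
    1 < dep v -> desc v t -> walk (G :\ [set par v; v]) s t k ->
  exists2 j, walk (H :\ [set par v; v]) s t j & (j%:R <= alpha * k%:R + beta)%R.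
Proof.
move=> a1 spS v1 vt; set e := [set par v; v].
have [root par_dep edge] := tree; have [refl up down] := sub.
have s1 : dep s = 1 by apply/root.
have nvs : ~~ desc v s.
  apply/negP => vs; case: (eqVneq s v) => [sv|sv]; first by rewrite -sv s1 in v1.
  by have [] := up _ _ vs sv v1; rewrite s1.
move=> [p [pp lp <-]]; rewrite -lp in vt.
have [p1 [y [p2 [Ep nvx vy]]]] := path_crossing pp nvs vt.
set x := last s p1 in nvx; rewrite lp in vt.
move: pp lp; rewrite Ep cat_path last_cat /= -/x => /and3P[sx xy yt] lt.
move: xy; rewrite adjD1 => /andP[xye xy].
have GeG : G :\ e \subset G by apply: subD1set.
have wsx : walk G s x (size p1) by apply: walk_sub GeG _; exists p1.
have wyt : walk G y t (size p2) by apply: walk_sub GeG _; exists p2.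
have := dep_walk wsx; rewrite s1 => /(_ isT)/andP[x0 lex].
have /andP[y0 ley] := edge _ _ xy x0.
have cxy : crossing v x y by rewrite /crossing xy x0 nvx vy.
have [q wq leq] := spanner_walk (le_trans ler01 a1) spS (walk_trans (walk1 xy) wyt).
(* Since alpha is at least 1, [size p1] is at most alpha times itself, and [leq] accounts for the
   rest of the path. *)
suff [j wj lej]: exists2 j, walk (H :\ e) s t j & j <= size p1 + q.
  exists j => //; rewrite size_cat /= -add1n natrD mulrDr -addrA.
  apply: (@le_trans _ _ (size p1 + q)%:R%R); first by rewrite ler_nat.
  by rewrite natrD lerD // ler_peMl.
case: (walk_avoid_or_use e wq) => [wqe|[a [b [i [l [wa wb Ee Eq]]]]]].
  exists ((dep x).-1 + q); first last.
    by rewrite leq_add2r; case: (dep x) lex.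
  apply: walk_trans (root_walk_outside v1 x0 nvx) (walk_sub _ wqe).
  exact: setSD.
have SG : S \subset G by apply: subset_trans SH HG.
have [x' [y' [/and5P[_ x'0 nvx' vy' ne'] xyH' le']]] := swapH v1 cxy.
have [k1 wk1 ek1] := subtree_walk v1 vy'.
have [k2 wk2 ek2] := subtree_walk v1 vt.
have /eqP := Ee; rewrite /e eq_set2 => /orP Eab.
(* Only the sum of the depths of a and b enters the estimate, so the direction in which Q traverses
   e is irrelevant. *)
have {}Eab : dep a + dep b = dep v + dep (par v).
  by case: Eab => /andP[/eqP-> /eqP->] //; rewrite addnC.
have [_ dpv] := par_dep _ v1.
have a0 : 0 < dep a by have /andP[] := dep_walk (walk_sub SG wa) x0.
have /andP[_ le1] := dep_walk (walk_sym (walk_sub SG wa)) a0.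
have abG : adj G a b by rewrite /adj -Ee; have [] := par_dep _ v1.
have /andP[b0 _] := edge _ _ abG a0.
have /andP[_ le2] := dep_walk (walk_sub SG wb) b0.
(* This length is dep x' + dep y' + dep t - 2 dep v. Both halves of Q give q at least dep x + dep t
   - 2 dep v + 2, and [lex] gives [size p1] at least dep x - 1; minimality of the swap and dep y at
   most dep x + 1 close the gap exactly. *)
exists ((dep x').-1 + 1 + k1 + k2); first last.
  move: x'0 dpv le1 le2 Eab le' ek1 ek2 ley lex; rewrite Eq; clear; lia.
apply: walk_trans wk2; apply: walk_trans (walk_sym wk1).
apply: walk_trans (root_walk_outside v1 x'0 nvx') (walk1 _).
by rewrite adjD1 ne'.
Qed.

Lemma swap_EABFS (R : realType) (alpha beta : R) :
    (1 <= alpha)%R -> (0 <= beta)%R -> spanner alpha beta G S ->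
  EABFS alpha beta G s H.
Proof.
move=> a1 b0 spS; split=> // e _ t; have [root par_dep edge] := tree.
(* If t is cut off from s in G - e, the right-hand side is infinite because alpha is positive. *)
have [->|[k wk ->]] := dist_walk R (G :\ e) s t.
  by rewrite gt0_muley ?lte_fin ?(lt_le_trans ltr01) // addye // leey.
rewrite -EFinM -EFinD.
suff [j wj lej]: exists2 j, walk (H :\ e) s t j & (j%:R <= alpha * k%:R + beta)%R.
  by apply: le_trans (dist_le_walk R wj) _; rewrite lee_fin.
have s1 : dep s = 1 by apply/root.
have := dep_walk (walk_sub (subD1set G e) wk); rewrite s1 => /(_ isT).
move=> /andP[t0 le_t].
have near : walk (H :\ e) s t (dep t).-1 ->
    exists2 j, walk (H :\ e) s t j & (j%:R <= alpha * k%:R + beta)%R.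
  move=> w; exists (dep t).-1 => //.
  apply: (@le_trans _ _ k%:R%R); first by rewrite ler_nat; lia.
  by rewrite -[leLHS]addr0 lerD // ler_peMl.
(* If e is no tree edge, the whole tree survives and depth is still attained. *)
case: (pickP [pred v | (1 < dep v) && (e == [set par v; v])]) => /= [v|none].
  move=> /andP[v1 /eqP Ee]; rewrite Ee in wk near *.
  case: (boolP (desc v t)) => [vt|nvt]; first exact: swap_walk.
  exact/near/root_walk_outside.
apply: near; apply: (root_walk (Q := predT)) => // w _ w1; split=> //.
by have /= := none w; rewrite w1 eq_sym => /negbT.
Qed.

End SwapEdges.
End Walks.

(** * Breadth-first search *)

(** Double loops are verified with an invariant indexed by the set of examined pairs, which hides
    the order of examination from the later proofs. *)
Lemma run_for_pairs n (J : rel 'I_n -> state -> Prop) r1 r2 c st :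
    let loop := LFor r1 (LFor r2 c) in
    counters_ok loop -> 0 \notin writes loop -> regs st 0 = n ->
    (forall done done' st1, subrel done' done -> J done st1 -> J done' st1) ->
    (forall done st1 r k, r \in [:: r1; r2] ->
       J done st1 -> J done (set_reg st1 r k)) ->
    (forall (x y : 'I_n) done st1, regs st1 r1 = x -> regs st1 r2 = y ->
       (forall q, q \notin writes loop -> regs st1 q = regs st q) ->
       J done st1 -> J (relU done (fun x' y' => (x' == x) && (y' == y))) (run c st1)) ->
  J (fun _ _ => false) st -> J (fun _ _ => true) (run loop st).
Proof.
move=> loop ok w0 n0 Jsub Jreg Jstep J0.
(* The pairs that precede (i, j) lexicographically. *)
pose before i j : rel 'I_n := fun x y => (x < i) || (x == i :> nat) && (y < j).
have /andP[r1w ok'] : counters_ok loop := ok.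
have [r10 r20 c0] : [/\ 0 != r1, 0 != r2 & 0 \notin writes c].
  by move: w0; rewrite /= !inE !negb_or => /and3P[].
have w0' : 0 \notin writes (LFor r2 c) by rewrite inE negb_or r20.
suff H : J (before (regs st 0) 0) (run loop st).
  apply: (Jsub) H => x y _; rewrite /before n0 ltn_ord //.
apply: (@run_for_ind (fun i => J (before i 0))) => //.
  by apply: (Jreg); [rewrite inE eqxx|apply: (Jsub) J0 => x y; rewrite /before ltn0 andbF].
move=> i st1; rewrite n0 => lt_in ri frame Ji.
have n1 : regs st1 0 = n by rewrite frame.
apply: (Jreg); first by rewrite inE eqxx.
suff H : J (before i (regs st1 0)) (run (LFor r2 c) st1).
  apply: (Jsub) H => x y.
  by rewrite /before n1 ltn_ord ltn0 andbF andbT orbF ltnS leq_eqVlt orbC.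
apply: (@run_for_ind (fun j => J (before i j))) => //.
  by apply: (Jreg); [rewrite !inE eqxx orbT|].
move=> j st2; rewrite n1 => lt_jn rj frame2 Jj.
have ri2 : regs st2 r1 = i by rewrite frame2.
apply: (Jreg); first by rewrite !inE eqxx orbT.
apply: (Jsub) (Jstep (Ordinal lt_in) (Ordinal lt_jn) _ _ ri2 rj _ Jj).
  move=> x y; rewrite /before /= -!val_eqE /= ltnS [y <= j]leq_eqVlt.
  by case: (x < i) (x == i :> nat) (y == j :> nat) (y < j) => [] [] [] [].
move=> q qw; have q2 : q \notin writes (LFor r2 c).
  by move: qw; rewrite [q \in _]inE negb_or => /andP[].
by rewrite frame2 // frame.
Qed.

Section BFS.
Variables (n : nat) (G : {set {set 'I_n}}) (s : 'I_n).
Implicit Types (x y v w : 'I_n) (d : 'I_n -> nat) (p : 'I_n -> 'I_n).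

(* In round k the neighbours of the vertices at distance k are labelled; [done]  *)
(* holds the pairs already examined in this round. *)
Definition bfs_inv k (done : rel 'I_n) d p :=
  [/\ forall x, d x = 1 <-> x = s,
      forall y, 1 < d y -> adj G (p y) y /\ d y = (d (p y)).+1,
      forall x, d x <= k.+2
    & forall x y, adj G x y -> 0 < d x ->
        (d x <= k) || (d x == k.+1) && done x y -> 0 < d y <= (d x).+1].

Lemma bfs_inv_sub k done done' d p : subrel done' done ->
  bfs_inv k done d p -> bfs_inv k done' d p.
Proof.
move=> sub [root par bound edge]; split=> // x y xy dx h; apply: edge => //.
by case/orP: h => [->//|/andP[-> /sub ->]]; rewrite orbT.
Qed.

Lemma bfs_inv_next k d p :
  bfs_inv k (fun _ _ => true) d p -> bfs_inv k.+1 (fun _ _ => false) d p.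
Proof.
move=> [root par bound edge]; split=> // [x|x y xy dx h].
  exact: leq_trans (bound x) _.
by apply: edge => //; move: h; rewrite andbF orbF andbT leq_eqVlt orbC.
Qed.

Lemma bfs_inv_skip k done d p x y :
  ~~ [&& d x == k.+1, adj G x y & d y == 0] -> bfs_inv k done d p ->
  bfs_inv k (relU done (fun x' y' => (x' == x) && (y' == y))) d p.
Proof.
move=> skip [root par bound edge]; split=> // x' y' xy dx.
rewrite /= andb_orr orbA => /orP[|]; first exact: edge.
move=> /andP[/eqP dk /andP[/eqP ex /eqP ey]]; subst x' y'.
by move: skip; rewrite dk eqxx xy /= lt0n => ->; exact: bound.
Qed.

(** A neighbour of y with label at most k would already have forced a label on y, so k + 2 exceeds
    no labelled neighbour's label by more than 1. The edges leaving y carry no obligation yet, since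
    its label is above k + 1. *)
Lemma bfs_inv_label k done d p x y :
  d x = k.+1 -> adj G x y -> d y = 0 -> bfs_inv k done d p ->
  bfs_inv k (relU done (fun x' y' => (x' == x) && (y' == y)))
    [eta d with y |-> k.+2] [eta p with y |-> x].
Proof.
move=> dx xy dy [root par bound edge].
have xNy : (x == y) = false by apply/eqP => e; rewrite e dy in dx.
split=> /= [z|z|z|x' y'].
- case: eqP => [->|_]; last exact: root.
  by split=> // ys; rewrite ((root y).2 ys) in dy.
- case: eqP => [->|_]; first by rewrite xNy dx.
  move=> dz; have [pz ez] := par z dz; split=> //.
  by case: eqP => // e; rewrite e dy in ez; rewrite ez in dz.
- by case: eqP.
- move=> xy'; case: (x' =P y) => [_ _|_ dx' h].
    by case/orP=> [|/andP[/eqP]]; lia.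
  case: eqP => [ey|ney]; last first.
    apply: edge => //; move: h; rewrite andb_orr orbA; case/orP=> //.
    by move=> /andP[_ /andP[_ /eqP]].
  rewrite /= ltnS.
  case: (leqP (d x') k) => [le_k|//]; have := edge _ _ xy' dx'.
  by rewrite le_k ey dy => /(_ isT).
Qed.

(** The ancestors of x realise every label from 1 to [d x], so there are at least [d x] vertices.
    Hence n rounds exhaust the search. *)
Lemma bfs_inv_dep k done d p x : bfs_inv k done d p -> d x <= n.
Proof.
move=> [_ par _ _]; suff: d x <= #|[pred z | 0 < d z <= d x]|.
  by move/leq_trans; apply; rewrite -[leqRHS]card_ord max_card.
move dx: (d x) => m; elim: m x dx => // m IHm x dx.
case: (posnP m) => [m0|m_gt0].
  by rewrite (cardD1 x) inE dx /= leqnn m0.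
have [|_ dpx] := par x; first by rewrite dx.
rewrite dx in dpx; case: dpx => /esym/IHm le_m.
rewrite (cardD1 x) inE dx leqnn add1n ltnS; apply: leq_trans le_m _.
apply/subset_leq_card/subsetP => z; rewrite !inE => /andP[z0 zm].
rewrite z0 (leqW zm) /= andbT.
by apply: contraTneq zm => ->; rewrite dx ltnn.
Qed.

Lemma bfs_inv_tree d p : bfs_inv n (fun _ _ => false) d p -> bfs_tree G s d p.
Proof.
move=> inv; have [root par _ edge] := inv; split=> // x y xy dx.
by apply: edge => //; rewrite (bfs_inv_dep x inv).
Qed.

Lemma bfs_inv_init p :
  bfs_inv 0 (fun _ _ => false) [eta (fun=> 0) with s |-> 1] p.
Proof.
split=> /= [x|x|x|x y _].
- by case: eqP.
- by case: eqP.
- by case: eqP.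
- by case: eqP.
Qed.

(** * Subtrees recognised by climbing parent links *)

Definition climb_step d p v w := if (w != v) && (1 < d w) then p w else w.

(** A fixed number n of steps is what a counted loop can execute; it suffices because depths are at
    most n. *)
Definition desc d p v w := iter n (climb_step d p v) w == v.

(** Each effective step lowers the depth by one, so the climb is stationary by then, and starting at
    a child instead of its parent does not change where it ends. *)
Lemma climb_stop d p v m w : bfs_tree G s d p -> d w <= m ->
  climb_step d p v (iter m (climb_step d p v) w) = iter m (climb_step d p v) w.
Proof.
move=> [_ par _]; elim: m w => [|m IHm] w le_m.
  by move: le_m; rewrite leqn0 /climb_step /= => /eqP ->; rewrite andbF.
rewrite iterSr; case: (boolP ((w != v) && (1 < d w))) => [|stop].
  by move=> /andP[wv w1]; apply: IHm; rewrite /climb_step wv w1;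
    have [_ dw] := par _ w1; rewrite dw in le_m.
have fw : climb_step d p v w = w by rewrite /climb_step (negbTE stop).
by rewrite fw iter_fix.
Qed.

Lemma desc_subtrees d p : bfs_tree G s d p -> (forall x, d x <= n) ->
  subtrees d p (desc d p).
Proof.
move=> tree bound; have [_ par _] := tree; have fix_v v : climb_step d p v v = v.
  by rewrite /climb_step eqxx.
have refl v : desc d p v v by rewrite /desc iter_fix.
split=> // [v w vw wv _|v w w1 vpw].
  case: (leqP (d w) 1) => [le1|w1].
    move: vw; rewrite /desc iter_fix ?(negbTE wv) // /climb_step.
    by rewrite (leq_gtF le1) andbF.
  split=> //; rewrite /desc -[p w](_ : climb_step d p v w = _); last first.
    by rewrite /climb_step wv w1.
  by rewrite -iterSr iterS (eqP vw) fix_v.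
case: (eqVneq w v) => [->//|wv].
move: vpw; rewrite /desc -[p w](_ : climb_step d p v w = _); last first.
  by rewrite /climb_step wv w1.
by rewrite -iterSr iterS (climb_stop _ tree).
Qed.
End BFS.

(** * The program *)

Lemma nth_flatten_rows (T : Type) x0 n (rows : seq (seq T)) i j :
    all (fun r => size r == n) rows -> j < n ->
  nth x0 (flatten rows) (i * n + j) = nth x0 (nth [::] rows i) j.
Proof.
move=> + lt_jn; elim: rows i => [|r rows IH] i /=; first by rewrite !nth_nil.
move=> /andP[/eqP sz_r sz]; rewrite nth_cat sz_r; case: i => [|i] /=.
  by rewrite lt_jn.
by rewrite mulSn -addnA ltnNge leq_addr /= addKn IH.
Qed.

Lemma size_adj_seq n (G : {set {set 'I_n}}) : size (adj_seq G) = n * n.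
Proof. by rewrite size_allpairs size_enum_ord. Qed.

Lemma nth_adj_seq n (G : {set {set 'I_n}}) (x y : 'I_n) :
  nth 0 (adj_seq G) (x * n + y) = adj G x y.
Proof.
rewrite /adj_seq nth_flatten_rows //; last first.
  by apply/allP => r /mapP[i _ ->]; rewrite size_map size_enum_ord.
by rewrite (nth_map x) ?size_enum_ord // (nth_map x) ?size_enum_ord // !nth_ord_enum.
Qed.

Lemma cell_lt n (x y : 'I_n) : x * n + y < n * n.
Proof. by have := ltn_ord x; have := ltn_ord y; nia. Qed.

Lemma cell_inj n (x y x' y' : 'I_n) :
  (x * n + y == x' * n + y') = (x == x') && (y == y').
Proof.
have n0 : 0 < n by apply: leq_trans (ltn_ord x).
apply/eqP/andP => [e|[/eqP-> /eqP->]//].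
have := congr1 (divn^~ n) e; have := congr1 (modn^~ n) e.
rewrite !modnMDl !divnMDl // !modn_small // !divn_small // !addn0.
by move=> ey ex; split; apply/eqP/val_inj.
Qed.

(* Registers: 0 holds n, 1 holds s, and 2 to 5 hold the start addresses of S    *)
(* (later H), of the table x |-> x * n (there is no multiplication), of the     *)
(* labels [d] and of the parents [p]; 6 counts the search rounds, 7 and 8 are   *)
(* the examined pair, 9 is v, 10 and 11 are the results of climbing the tree    *)
(* from this pair, and 12 to 14 are the best depth sum and swap edge so far. *)
Definition row_of a := Cell (Add (Reg 3) a).
Definition G_at a b := Cell (Add (row_of a) b).
Definition H_addr a b := Add (Reg 2) (Add (row_of a) b).
Definition d_addr a := Add (Reg 4) a.
Definition p_addr a := Add (Reg 5) a.
Definition d_at a := Cell (d_addr a).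
Definition p_at a := Cell (p_addr a).
(** With truncated subtraction this is the absolute difference. *)
Definition neq a b := Add (Defs.Sub a b) (Defs.Sub b a).
Definition eqe a b := Defs.Sub (Cst 1) (neq a b).

Definition add_edge a b :=
  LSeq (LStore (H_addr a b) (Cst 1)) (LStore (H_addr b a) (Cst 1)).

Definition setup :=
  LSeq (LFor 6 (LAssign 2 (Add (Reg 2) (Reg 0))))
  (LSeq (LSeq (LAssign 3 (Add (Reg 2) (Reg 2)))
    (LSeq (LAssign 4 (Add (Reg 3) (Reg 0))) (LAssign 5 (Add (Reg 4) (Reg 0)))))
  (LSeq (LFor 6 (LSeq (LStore (Add (Reg 3) (Reg 6)) (Reg 7))
                  (LAssign 7 (Add (Reg 7) (Reg 0)))))
  (LStore (d_addr (Reg 1)) (Cst 1)))).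

Definition bfs_visit :=
  LWhen (eqe (d_at (Reg 7)) (Add (Reg 6) (Cst 1)))
  (LWhen (G_at (Reg 7) (Reg 8))
  (LWhen (eqe (d_at (Reg 8)) (Cst 0))
  (LSeq (LStore (d_addr (Reg 8)) (Add (Reg 6) (Cst 2)))
        (LStore (p_addr (Reg 8)) (Reg 7))))).

Definition bfs := LFor 6 (LFor 7 (LFor 8 bfs_visit)).

Definition climb r :=
  LFor 15 (LWhen (neq (Reg r) (Reg 9))
    (LWhen (Defs.Sub (d_at (Reg r)) (Cst 1)) (LAssign r (p_at (Reg r))))).

Definition climb_ends :=
  LSeq (LAssign 10 (Reg 7)) (LSeq (climb 10)
  (LSeq (LAssign 11 (Reg 8)) (climb 11))).

(** The innermost test succeeds when the recorded sum is 0, meaning none so far, or exceeds the new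
    one. *)
Definition improve_swap :=
  LWhen (G_at (Reg 7) (Reg 8))
  (LWhen (d_at (Reg 7))
  (LWhen (neq (Reg 10) (Reg 9))
  (LWhen (eqe (Reg 11) (Reg 9))
  (LWhen (Add (neq (Reg 7) (p_at (Reg 9))) (neq (Reg 8) (Reg 9)))
  (LWhen (Add (Defs.Sub (Cst 1) (Reg 12))
            (Defs.Sub (Reg 12) (Add (d_at (Reg 7)) (d_at (Reg 8)))))
  (LSeq (LAssign 12 (Add (d_at (Reg 7)) (d_at (Reg 8))))
  (LSeq (LAssign 13 (Reg 7)) (LAssign 14 (Reg 8))))))))).

Definition find_swap := LFor 7 (LFor 8 (LSeq climb_ends improve_swap)).

Definition augment :=
  LFor 9 (LSeq (LAssign 12 (Cst 0)) (LSeq find_swap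
    (LSeq (LWhen (Reg 12) (add_edge (Reg 13) (Reg 14)))
          (LWhen (Defs.Sub (d_at (Reg 9)) (Cst 1))
             (add_edge (Reg 9) (p_at (Reg 9))))))).

Definition copy_out :=
  LSeq (LAssign 15 (Cst 0))
    (LFor 7 (LFor 8 (LSeq (LStore (Reg 15) (Cell (Add (Reg 2) (Reg 15))))
                          (LAssign 15 (Add (Reg 15) (Cst 1)))))).

Definition eabfs := LSeq setup (LSeq bfs (LSeq augment copy_out)).

Lemma eval_neq st a b : (eval st (neq a b) != 0) = (eval st a != eval st b).
Proof. by rewrite /=; lia. Qed.

Lemma eval_eqe st a b : (eval st (eqe a b) != 0) = (eval st a == eval st b).
Proof. by rewrite /=; lia. Qed.

Lemma eval_gt1 st a : (eval st (Defs.Sub a (Cst 1)) != 0) = (1 < eval st a).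
Proof. by rewrite /=; lia. Qed.

Lemma eval_or st a b :
  (eval st (Add a b) != 0) = (eval st a != 0) || (eval st b != 0).
Proof. by rewrite /= addn_eq0 negb_and. Qed.

Lemma run_when st a c :
  run (LWhen a c) st = if eval st a != 0 then run c st else st.
Proof. by []. Qed.

Lemma run_seq st c1 c2 : run (LSeq c1 c2) st = run c2 (run c1 st).
Proof. by []. Qed.

(** * Memory layout and its preservation *)

Section Correctness.
Variables (n : nat) (G : {set {set 'I_n}}) (s : 'I_n).
Implicit Types (x y v w : 'I_n) (d : 'I_n -> nat) (p : 'I_n -> 'I_n).
Implicit Types (H S : {set {set 'I_n}}) (h : rel 'I_n).

(** The output table holds an arbitrary relation [h], since between the two stores of [add_edge] it
    need not be symmetric. *)
Record represents (m : nat -> nat) h d p : Prop := Represents {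
  rep_G : forall x y, m (x * n + y) = adj G x y;
  rep_H : forall x y, m (n * n + (x * n + y)) = h x y :> nat;
  rep_row : forall x, m (n * n + n * n + x) = x * n;
  rep_d : forall x, m (n * n + n * n + n + x) = d x;
  rep_p : forall x, m (n * n + n * n + n + n + x) = p x }.

Record bases st : Prop := Bases {
  base0 : regs st 0 = n;
  base2 : regs st 2 = n * n;
  base3 : regs st 3 = n * n + n * n;
  base4 : regs st 4 = n * n + n * n + n;
  base5 : regs st 5 = n * n + n * n + n + n }.

Definition good st h d p := bases st /\ represents (Defs.mem st) h d p.

Lemma good_frame st st1 h d p :
    (forall q, q < 6 -> regs st1 q = regs st q) -> Defs.mem st1 = Defs.mem st ->
  good st h d p -> good st1 h d p.
Proof.
move=> eq_r eq_m [[? ? ? ? ?] ?]; split; rewrite ?eq_m //.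
by split; rewrite eq_r.
Qed.

Lemma good_set_reg st r k h d p :
  5 < r -> good st h d p -> good (set_reg st r k) h d p.
Proof.
move=> r5; apply: good_frame => // q q6 /=.
by case: eqP => // e; rewrite e ltnNge r5 in q6.
Qed.

Section Access.
Variables (st : state) (h : rel 'I_n) (d : 'I_n -> nat) (p : 'I_n -> 'I_n).
Hypothesis st_good : good st h d p.
Variables (a b : expr) (x y : 'I_n).
Hypotheses (ax : eval st a = x) (bx : eval st b = y).

Lemma eval_G_at : eval st (G_at a b) = adj G x y.
Proof.
by have [B R] := st_good; rewrite /= ax bx (base3 B) (rep_row R) (rep_G R).
Qed.

Lemma eval_H_addr : eval st (H_addr a b) = n * n + (x * n + y).
Proof.
by have [B R] := st_good; rewrite /= ax bx (base3 B) (rep_row R) (base2 B).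
Qed.

Lemma eval_d_addr : eval st (d_addr a) = n * n + n * n + n + x.
Proof. by have [B R] := st_good; rewrite /= ax (base4 B). Qed.

Lemma eval_p_addr : eval st (p_addr a) = n * n + n * n + n + n + x.
Proof. by have [B R] := st_good; rewrite /= ax (base5 B). Qed.

Lemma eval_d_at : eval st (d_at a) = d x.
Proof. by have [B R] := st_good; rewrite /= ax (base4 B) (rep_d R). Qed.

Lemma eval_p_at : eval st (p_at a) = p x.
Proof. by have [B R] := st_good; rewrite /= ax (base5 B) (rep_p R). Qed.
End Access.

Lemma represents_d m h d p y k : represents m h d p ->
  represents [eta m with n * n + n * n + n + y |-> k] h [eta d with y |-> k] p.
Proof.
have ltx x := ltn_ord x.
move=> [rG rH rr rd rp]; split=> [x z|x z|x|x|x] /=.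
- by rewrite ifN // neq_ltn; have := cell_lt x z; lia.
- by rewrite ifN // neq_ltn; have := cell_lt x z; lia.
- by rewrite ifN // neq_ltn; have := ltx x; lia.
- by rewrite eqn_add2l val_eqE rd.
- by rewrite ifN // neq_ltn; have := ltx y; lia.
Qed.

Lemma represents_p m h d p y x : represents m h d p ->
  represents [eta m with n * n + n * n + n + n + y |-> val x] h d [eta p with y |-> x].
Proof.
have ltx x' := ltn_ord x'.
move=> [rG rH rr rd rp]; split=> [z t|z t|z|z|z] /=.
- by rewrite ifN // neq_ltn; have := cell_lt z t; lia.
- by rewrite ifN // neq_ltn; have := cell_lt z t; lia.
- by rewrite ifN // neq_ltn; have := ltx z; lia.
- by rewrite ifN // neq_ltn; have := ltx z; lia.
- by rewrite eqn_add2l val_eqE rp; case: (z == y).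
Qed.

Lemma represents_h m h d p x y : represents m h d p ->
  represents [eta m with n * n + (x * n + y) |-> 1]
    (relU h (fun x' y' => (x' == x) && (y' == y))) d p.
Proof.
have ltx x' := ltn_ord x'; have lt := cell_lt x y.
move=> [rG rH rr rd rp]; split=> [z t|z t|z|z|z] /=.
- by rewrite ifN // neq_ltn; have := cell_lt z t; lia.
- rewrite eqn_add2l cell_inj rH.
  by case: ifP => //; rewrite ?orbF ?orbT.
- by rewrite ifN // neq_ltn; have := ltx z; lia.
- by rewrite ifN // neq_ltn; have := ltx z; lia.
- by rewrite ifN // neq_ltn; have := ltx z; lia.
Qed.

(** The second store evaluates [a] and [b] in the memory left by the first, and they may read the
    parent table; hence their values are required to be the same for every output table [h]. *)
Lemma run_add_edge st H d p a b x y :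
    good st (adj H) d p ->
    (forall m h, represents m h d p ->
      eval (State (regs st) m) a = x /\ eval (State (regs st) m) b = y) ->
  good (run (add_edge a b) st) (adj ([set x; y] |: H)) d p.
Proof.
move=> st_good ab; have [B R] := st_good.
have [ax bx] : eval st a = x /\ eval st b = y.
  by case: st B R {st_good} ab => r m B R ab; apply: ab R.
pose st1 := set_mem st (eval st (H_addr a b)) 1.
rewrite -[run _ _]/(set_mem st1 (eval st1 (H_addr b a)) 1).
have st1_good : good st1 (relU (adj H) (fun x' y' => (x' == x) && (y' == y))) d p.
  split; first by case: B => *; split.
  by rewrite /st1 (eval_H_addr st_good ax bx); apply: represents_h.
have [_ R1] := st1_good; have [ax1 bx1] := ab _ _ R1.
rewrite (eval_H_addr st1_good bx1 ax1).
split; first by case: B => *; split.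
have [rG rH rr rd rp] := represents_h y x R1; split=> // i j.
by apply: etrans (rH i j) _; rewrite /adj !inE eq_set2 /= [in RHS]orbC orbA.
Qed.

Lemma run_climb r st h d p v x : r = 10 \/ r = 11 ->
    good st h d p -> regs st 9 = v -> regs st r = x ->
  regs (run (climb r) st) r = iter n (climb_step d p v) x.
Proof.
move=> r_cases st_good st9 str; have [B _] := st_good.
have r_ok : [&& r != 0, r != 15, r != 9 & 5 < r] by case: r_cases => ->.
have [r0 r15 r9 r5] := and4P r_ok.
pose I k st' := regs st' r = iter k (climb_step d p v) x /\ Defs.mem st' = Defs.mem st.
suff: I (regs st 0) (run (climb r) st) by rewrite (base0 B) => -[].
apply: run_for_ind => [|||k st1 _ _ frame [str1 mem1]].
- by case: r_cases => ->.
- by case: r_cases => ->.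
- by rewrite /I /= (negbTE r15).
have st1_good : good st1 h d p.
  apply: good_frame mem1 st_good => q q6; apply: frame.
  rewrite /= !inE negb_or; lia.
have st19 : regs st1 9 = v by rewrite frame // !inE /= eq_sym.
rewrite /I iterS; set w := iter k _ _ in str1 *.
rewrite -[regs (set_reg _ _ _) r]/(if r == 15 then _ else _) (negbTE r15).
have ew : eval st1 (Reg r) = w by [].
have ev : eval st1 (Reg 9) = v by [].
rewrite run_when eval_neq ew ev [_ == _ :> nat]val_eqE /climb_step.
case: (w != v); last by rewrite str1.
rewrite run_when eval_gt1 (eval_d_at st1_good ew).
case: (1 < d w); last by rewrite str1.
rewrite -[run _ _]/(set_reg st1 r (eval st1 (p_at (Reg r)))).
by rewrite (eval_p_at st1_good ew) /= eqxx.
Qed.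

Lemma run_climb_ends st h d p v x y :
    good st h d p -> regs st 9 = v -> regs st 7 = x -> regs st 8 = y ->
  let st1 := run climb_ends st in
  [/\ good st1 h d p, forall q, q \notin [:: 10; 11; 15] -> regs st1 q = regs st q,
      regs st1 10 = iter n (climb_step d p v) x
    & regs st1 11 = iter n (climb_step d p v) y].
Proof.
move=> st_good st9 st7 st8 st1.
have frame c q st' : q \notin writes c -> regs (run c st') q = regs st' q.
  exact: regs_run.
rewrite /st1 /climb_ends !run_seq.
set sta := run (LAssign 10 _) st; set stb := run (climb 10) sta.
set stc := run (LAssign 11 _) stb.
have sta_good : good sta h d p by apply: good_set_reg.
have stb_good : good stb h d p.
  apply: good_frame sta_good; last by rewrite mem_run.
  by move=> q q6; rewrite frame // !inE; lia.
have stc_good : good stc h d p by apply: good_set_reg.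
split.
- apply: good_frame stc_good; last by rewrite mem_run.
  by move=> q q6; rewrite frame // !inE; lia.
- move=> q; rewrite !inE => /norP[q10 /norP[q11 q15]].
  rewrite frame ?inE ?negb_or ?q11 ?q15 // /stc /= (negbTE q11).
  by rewrite -/(regs stb q) frame ?inE ?negb_or ?q10 ?q15 //= (negbTE q10).
- rewrite frame // -[LHS]/(regs stb 10).
  by apply: (run_climb (or_introl erefl)) sta_good _ _.
- apply: (run_climb (or_intror erefl)) stc_good _ _.
    by rewrite -[LHS]/(regs stb 9) frame.
  by rewrite -[LHS]/(regs stb 8) frame.
Qed.

Definition best_of v (done : rel 'I_n) d p (b bx by_ : nat) :=
  (* As crossing edges have positive depths, b = 0 means that none was found. *)
  (b = 0 /\ forall x y, done x y -> ~~ crossing G d p (desc d p) v x y) \/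
  exists x y,
    [/\ bx = x, by_ = y, b = d x + d y, crossing G d p (desc d p) v x y
      & forall x' y', done x' y' -> crossing G d p (desc d p) v x' y' ->
          b <= d x' + d y'].

(** The reversed orientation of the parent edge would need x = v, which is impossible for x outside
    T_v; so comparing ordered pairs is enough. *)
Lemma crossingE d p v x y :
  crossing G d p (desc d p) v x y =
  [&& adj G x y, 0 < d x, iter n (climb_step d p v) x != v,
      iter n (climb_step d p v) y == v & (x != p v) || (y != v)].
Proof.
rewrite /crossing /desc; case: (adj G x y) => //=; case: (0 < d x) => //=.
case: (iter n _ x =P v) => //= nx; case: (iter n _ y == v) => //=.
rewrite eq_set2 negb_or !negb_and; case: (x =P v) => [xv|_]; last by rewrite andbT.
by case: nx; rewrite xv iter_fix // /climb_step eqxx.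
Qed.

Lemma run_improve_swap st h d p v x y done :
    good st h d p -> regs st 9 = v -> regs st 7 = x -> regs st 8 = y ->
    regs st 10 = iter n (climb_step d p v) x ->
    regs st 11 = iter n (climb_step d p v) y ->
    best_of v done d p (regs st 12) (regs st 13) (regs st 14) ->
  let st1 := run improve_swap st in
  best_of v (relU done (fun x' y' => (x' == x) && (y' == y))) d p
    (regs st1 12) (regs st1 13) (regs st1 14).
Proof.
move=> st_good st9 st7 st8 st10 st11 best.
have skip : ~~ crossing G d p (desc d p) v x y ->
    best_of v (relU done (fun x' y' => (x' == x) && (y' == y))) d p
      (regs st 12) (regs st 13) (regs st 14).
  move=> ncr; case: best => [[-> none]|[x1 [y1 [-> -> -> cr min]]]].
    by left; split=> // x' y' /orP[/none|/andP[/eqP-> /eqP->]].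
  right; exists x1, y1; split=> // x' y' /orP[/min//|/andP[/eqP-> /eqP->]].
  by rewrite (negbTE ncr).
have ex : eval st (Reg 7) = x by [].
have ey : eval st (Reg 8) = y by [].
have ev : eval st (Reg 9) = v by [].
(* The tests of the program follow the conjuncts of [crossingE] in order; whenever one fails, [skip]
   applies. *)
move: skip; rewrite crossingE /improve_swap; have := crossingE d p v x y.
rewrite run_when (eval_G_at st_good ex ey) eqb0 negbK.
case: (adj G x y); last by move=> _; apply.
rewrite run_when (eval_d_at st_good ex) -lt0n; case: (0 < d x); last by move=> _; apply.
rewrite run_when eval_neq ev -[eval _ _]/(regs st 10) st10 [_ == _ :> nat]val_eqE.
case: (iter n _ x == v); first by move=> _; apply.
rewrite run_when eval_eqe ev -[eval _ _]/(regs st 11) st11 [_ == _ :> nat]val_eqE.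
case: (iter n _ y == v); last by move=> _; apply.
rewrite run_when eval_or !eval_neq ex ey ev (eval_p_at st_good ev).
rewrite ![_ == _ :> nat]val_eqE.
case: ((x != p v) || (y != v)); last by move=> _; apply.
move=> /= cr _; set b := regs st 12 in best *.
have -> : Defs.mem st (regs st 4 + regs st 7) = d x := eval_d_at st_good ex.
have -> : Defs.mem st (regs st 4 + regs st 8) = d y := eval_d_at st_good ey.
case: ifP => [better|worse] /=.
  right; exists x, y; split=> // x' y' /orP[dxy cr'|/andP[/eqP-> /eqP->]//].
  case: best => [[_ /(_ x' y' dxy)]|[x1 [y1 [_ _ eb /and5P[_ d1 _ _ _] min]]]].
    by rewrite cr'.
  (* A recorded sum is positive because d x1 is, so [better] is here a strict improvement. *)
  by have := min x' y' dxy cr'; move: better d1; rewrite eb; clear; lia.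
case: best => [[b0]|[x1 [y1 [-> -> eb cr1 min]]]]; first by rewrite b0 in worse.
right; exists x1, y1; split=> // x' y' /orP[/min//|/andP[/eqP-> /eqP->] _].
by move: worse; clear; lia.
Qed.

Lemma run_find_swap st h d p v :
    good st h d p -> regs st 9 = v -> regs st 12 = 0 ->
  let st1 := run find_swap st in
  best_of v (fun _ _ => true) d p (regs st1 12) (regs st1 13) (regs st1 14).
Proof.
move=> st_good st9 st12.
pose J done st1 := [/\ good st1 h d p, regs st1 9 = v &
  best_of v done d p (regs st1 12) (regs st1 13) (regs st1 14)].
suff [] : J (fun _ _ => true) (run find_swap st) by [].
apply: run_for_pairs => //.
- by have [[]] := st_good.
- move=> done done' st1 sub [gd e9 best]; split=> //.
  case: best => [[b0 none]|[x [y [ex ey eb cr min]]]].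
    by left; split=> // x y /sub/none.
  by right; exists x, y; split=> // x' y' /sub/min.
- by move=> done st1 r k; rewrite !inE => /orP[]/eqP-> [gd e9 best]; split=> //;
    apply: good_set_reg.
- move=> x y done st1 e7 e8 frame [gd e9 best].
  have [gd2 fr2 e10 e11] := run_climb_ends gd e9 e7 e8.
  rewrite run_seq; set st2 := run climb_ends st1 in gd2 fr2 e10 e11 *.
  split.
  + apply: good_frame gd2; last by rewrite mem_run.
    by move=> q q6; rewrite regs_run // !inE; lia.
  + by rewrite regs_run // fr2.
  + by apply: (run_improve_swap gd2) => //; rewrite !fr2.
- by split=> //; left; split.
Qed.

Definition augmented S d p v H :=
  1 < d v -> adj H (p v) v /\ has_best_swap G H d p (desc d p) v.

Lemma augmented_sub S d p v H H' : H \subset H' -> augmented S d p v H ->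
  augmented S d p v H'.
Proof.
move=> sub aug v1; have [pv best] := aug v1.
have adj_sub x y : adj H x y -> adj H' x y by apply: (subsetP sub).
split=> [|x y /best [x' [y' [cr xy le]]]]; first exact: adj_sub.
by exists x', y'; split=> //; apply: adj_sub.
Qed.

Lemma run_augment st S d p : S \subset G -> bfs_tree G s d p -> good st (adj S) d p ->
  exists H, [/\ good (run augment st) (adj H) d p, S \subset H, H \subset G,
     #|H| <= #|S| + 2 * n & forall v, augmented S d p v H].
Proof.
move=> SG [_ par _] st_good; have [B _] := st_good.
(* Later additions keep earlier vertices augmented, by [augmented_sub], and each vertex costs at
   most two edges. *)
pose I k st' := exists H, [/\ good st' (adj H) d p, S \subset H, H \subset G,
     #|H| <= #|S| + 2 * k & forall v, v < k -> augmented S d p v H].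
suff: I (regs st 0) (run augment st).
  rewrite (base0 B) => -[H [gd SH HG card aug]].
  by exists H; split=> // v; apply: aug.
apply: run_for_ind => //.
  by exists S; split=> //; rewrite ?addn0 //; apply: good_set_reg.
rewrite (base0 B) => k st1 lt_kn r9 _ [H [gd SH HG card aug]].
pose v := Ordinal lt_kn; have {}r9 : regs st1 9 = v by [].
rewrite !run_seq; set st2 := run find_swap _.
have gda : good (run (LAssign 12 (Cst 0)) st1) (adj H) d p by apply: good_set_reg.
have best := run_find_swap gda r9 erefl.
have gd2 : good st2 (adj H) d p.
  apply: good_frame gda; last by rewrite /st2 mem_run.
  by move=> q q6; rewrite /st2 regs_run // !inE; lia.
have r92 : regs st2 9 = v by rewrite /st2 regs_run.
rewrite -/st2 in best; set st3 := run (LWhen (Reg 12) _) st2.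
have [H1 [gd3 HH1 H1G card1 swap]] : exists H1, [/\ good st3 (adj H1) d p,
    H \subset H1, H1 \subset G, #|H1| <= #|H| + 1 &
    has_best_swap G H1 d p (desc d p) v].
  case: best => [[b0 none]|[x [y [ex ey eb cr min]]]].
    exists H; split=> //; last by move=> x y cr; have := none x y isT; rewrite cr.
      by rewrite /st3 run_when -[eval _ _]/(regs st2 12) b0.
    exact: leq_addr.
  have /and5P[xyG d0 _ _ _] := cr.
  exists ([set x; y] |: H); split.
  - rewrite /st3 run_when -[eval _ _]/(regs st2 12) ifT; last by rewrite eb; lia.
    exact: run_add_edge.
  - exact: subsetUr.
  - by rewrite subUset sub1set HG andbT.
  - by rewrite cardsU1 addnC leq_add2l leq_b1.
  move=> x' y' cr'; exists x, y; split=> //; first by rewrite /adj setU11.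
  by rewrite -eb; apply: min.
have r93 : regs st3 9 = v by rewrite /st3 regs_run.
set st4 := run (LWhen _ _) st3.
have [H2 [gd4 HH2 H2G card2 par2]] : exists H2, [/\ good st4 (adj H2) d p,
    H1 \subset H2, H2 \subset G, #|H2| <= #|H1| + 1 & 1 < d v -> adj H2 (p v) v].
  have ev : eval st3 (Reg 9) = v by [].
  rewrite /st4 run_when eval_gt1 (eval_d_at gd3 ev).
  case: (boolP (1 < d v)) => dv; last by exists H1; split=> //; apply: leq_addr.
  exists ([set v; p v] |: H1); split.
  - apply: run_add_edge => // m h R; have [B3 _] := gd3.
    have g : good (State (regs st3) m) h d p by split=> //; case: B3 => *; split.
    have ev' : eval (State (regs st3) m) (Reg 9) = v by [].
    by rewrite (eval_p_at g ev').
  - exact: subsetUr.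
  - by rewrite subUset sub1set H1G andbT; have [] := par _ dv; rewrite adjC.
  - by rewrite cardsU1 addnC leq_add2l leq_b1.
  - by rewrite adjC /adj setU11.
exists H2; split.
- exact: good_set_reg.
- exact: subset_trans SH (subset_trans HH1 HH2).
- by [].
- by move: card card1 card2; clear; lia.
move=> w; rewrite ltnS leq_eqVlt => /orP[/eqP wk|/aug aug_w]; last first.
  exact: augmented_sub (subset_trans HH1 HH2) aug_w.
have -> : w = v by apply: val_inj.
move=> dv; split; first exact: par2.
move=> x y /swap[x' [y' [cr xy le]]]; exists x', y'; split=> //.
exact: (subsetP HH2).
Qed.

(** * Correctness of the search program *)

Lemma run_bfs_visit st h d p k x y done :
    good st h d p -> bfs_inv G s k done d p ->
    regs st 6 = k -> regs st 7 = x -> regs st 8 = y ->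
  exists d' p', good (run bfs_visit st) h d' p' /\
    bfs_inv G s k (relU done (fun x' y' => (x' == x) && (y' == y))) d' p'.
Proof.
move=> st_good inv r6 r7 r8.
have ex : eval st (Reg 7) = x by [].
have ey : eval st (Reg 8) = y by [].
have ek1 : eval st (Add (Reg 6) (Cst 1)) = k.+1 by rewrite /= r6 addn1.
have ek2 : eval st (Add (Reg 6) (Cst 2)) = k.+2 by rewrite /= r6 addn2.
have skip : ~~ [&& d x == k.+1, adj G x y & d y == 0] -> exists d' p', good st h d' p' /\
    bfs_inv G s k (relU done (fun x' y' => (x' == x) && (y' == y))) d' p'.
  by move=> no; exists d, p; split=> //; apply: bfs_inv_skip.
rewrite /bfs_visit run_when eval_eqe (eval_d_at st_good ex) ek1.
case: (eqVneq (d x) k.+1) skip => [dx|_] skip; last exact: skip.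
rewrite run_when (eval_G_at st_good ex ey) eqb0 negbK.
case: (boolP (adj G x y)) skip => [xy|_] skip; last exact: skip.
rewrite run_when eval_eqe (eval_d_at st_good ey) -[eval st (Cst 0)]/0.
case: (eqVneq (d y) 0) skip => [dy|_] skip; last exact: skip.
exists [eta d with y |-> k.+2], [eta p with y |-> x]; split; last exact: bfs_inv_label.
rewrite run_seq; set st1 := run (LStore _ _) st.
have st1_good : good st1 h [eta d with y |-> k.+2] p.
  have [B R] := st_good; split; first by case: B => *; split.
  by rewrite /st1 -ek2 -[run _ _]/(set_mem st (eval st (d_addr (Reg 8))) (eval st _))
    (eval_d_addr st_good ey); apply: represents_d.
have ey1 : eval st1 (Reg 8) = y by [].
have [B R] := st1_good; split; first by case: B => *; split.
rewrite -[run _ _]/(set_mem st1 (eval st1 (p_addr (Reg 8))) (eval st1 (Reg 7))).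
by rewrite (eval_p_addr st1_good ey1) [eval _ _]r7; apply: represents_p.
Qed.

Lemma run_bfs st h d p :
    good st h d p -> bfs_inv G s 0 (fun _ _ => false) d p ->
  exists d' p', good (run bfs st) h d' p' /\ bfs_inv G s n (fun _ _ => false) d' p'.
Proof.
move=> st_good inv; have [B _] := st_good.
pose I k st' := exists d' p',
  good st' h d' p' /\ bfs_inv G s k (fun _ _ => false) d' p'.
suff: I (regs st 0) (run bfs st) by rewrite (base0 B).
apply: run_for_ind => //; first by exists d, p; split=> //; apply: good_set_reg.
move=> k st1 _ r6 _ [d1 [p1 [gd1 inv1]]].
pose J done st' := exists d' p', good st' h d' p' /\ bfs_inv G s k done d' p'.
suff [d2 [p2 [gd2 inv2]]] : J (fun _ _ => true) (run (LFor 7 (LFor 8 bfs_visit)) st1).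
  by exists d2, p2; split; [exact: good_set_reg|exact: bfs_inv_next].
apply: run_for_pairs => //.
- by have [[]] := gd1.
- move=> done done' st' sub [d' [p' [gd' inv']]]; exists d', p'; split=> //.
  exact: bfs_inv_sub sub inv'.
- move=> done st' r j; rewrite !inE => /orP[]/eqP-> [d' [p' [gd' inv']]];
    by exists d', p'; split=> //; apply: good_set_reg.
- move=> x y done st' r7 r8 frame [d' [p' [gd' inv']]].
  by apply: run_bfs_visit gd' inv' _ r7 r8; rewrite frame.
- by exists d1, p1.
Qed.

(** * Preparing the tables and writing the output *)

Lemma run_setup S :
  good (run setup (input_state G s S)) (adj S) [eta (fun=> 0) with s |-> 1]
    (fun=> Ordinal (leq_ltn_trans (leq0n s) (ltn_ord s))).
Proof.
set st := input_state G s S; set o := Ordinal _.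
rewrite /setup !run_seq; set st1 := run (LFor 6 _) st.
have mem1 : Defs.mem st1 = Defs.mem st by rewrite mem_run.
have r0 : regs st1 0 = n by rewrite regs_run.
have r1 : regs st1 1 = s by rewrite regs_run.
have r2 : regs st1 2 = n * n.
  pose I k (st' : state) := regs st' 2 = k * n.
  suff: I (regs st 0) st1 by [].
  apply: run_for_ind => // k st' _ _ frame; rewrite /I /= => ->.
  by rewrite frame // mulSn addnC.
have r7 : regs st1 7 = 0 by rewrite regs_run.
set st2 := run (LAssign 5 _) _.
have B2 : bases st2 by split; rewrite /= ?r0 ?r2.
have r12 : regs st2 1 = s by [].
have r72 : regs st2 7 = 0 by [].
have mem2 : Defs.mem st2 = Defs.mem st by [].
move: st2 B2 r12 r72 mem2 => st2 B2 r12 r72 mem2.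
set st3 := run (LFor 6 _) st2.
have [mem3 row3] : (forall a, ~~ (n * n + n * n <= a < n * n + n * n + n) ->
      Defs.mem st3 a = Defs.mem st a) /\
    forall x, Defs.mem st3 (n * n + n * n + x) = x * n.
  pose I k (st' : state) := [/\ regs st' 7 = k * n,
    forall a, ~~ (n * n + n * n <= a < n * n + n * n + n) ->
      Defs.mem st' a = Defs.mem st a &
    forall x, x < k -> Defs.mem st' (n * n + n * n + x) = x * n].
  suff: I (regs st2 0) st3.
    by rewrite (base0 B2) => -[_ me row]; split=> // x; apply: row.
  apply: run_for_ind => //; first by split=> //= a; rewrite mem2.
  rewrite (base0 B2) => k st' lt_kn r6 frame [r7' me row].
  have r3' : regs st' 3 = n * n + n * n by rewrite frame // (base3 B2).
  have r0' : regs st' 0 = n by rewrite frame // (base0 B2).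
  split=> /=.
  - by rewrite r7' r0' mulSn addnC.
  - by move=> a na; rewrite r3' r6 ifN ?me //; lia.
  - move=> x; rewrite r3' r6 r7' eqn_add2l ltnS leq_eqVlt.
    by case: eqP => [->//|_] /= /row.
have B3 : bases st3.
  by case: B2 => *; split; rewrite /st3 regs_run.
have r13 : regs st3 1 = s by rewrite /st3 regs_run.
(* Before the label of s is written, the label and parent tables are untouched memory. The zeros
   there read as unlabelled and as parent vertex 0, which is [o]. *)
suff R : represents (Defs.mem st3) (adj S) (fun=> 0) (fun=> o).
  have gd3 : good st3 (adj S) (fun=> 0) (fun=> o) by [].
  split; first by case: B3 => *; split.
  rewrite -[run _ _]/(set_mem st3 (eval st3 (d_addr (Reg 1))) 1).
  by rewrite (eval_d_addr gd3 (r13 : eval st3 (Reg 1) = s)); apply: represents_d.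
have memst a : Defs.mem st a = nth 0 (adj_seq G ++ adj_seq S) a by [].
split=> [x y|x y|x|x|x].
- have := cell_lt x y => lt; rewrite mem3; last by lia.
  by rewrite memst nth_cat size_adj_seq lt nth_adj_seq.
- have := cell_lt x y => lt; rewrite mem3; last by lia.
  by rewrite memst nth_cat size_adj_seq ltnNge leq_addr addKn nth_adj_seq.
- exact: row3.
- rewrite mem3; last by lia.
  by rewrite memst nth_default // size_cat !size_adj_seq -!addnA !leq_add2l leq_addr.
- rewrite mem3; last by lia.
  by rewrite memst nth_default // size_cat !size_adj_seq -!addnA !leq_add2l leq_addr.
Qed.

(** The copy overwrites only the table of G, below address n * n, so the source cells stay intact
    throughout; register 15 runs through the addresses k * n + l. *)
Lemma run_copy_out st d p H : good st (adj H) d p -> outputs (run copy_out st) H.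
Proof.
move=> st_good; have [B R] := st_good.
rewrite /outputs /copy_out run_seq; set st0 := run (LAssign _ _) st.
pose I c (st' : state) := [/\ regs st' 15 = c,
  forall a, a < c -> Defs.mem st' a = Defs.mem st (n * n + a) &
  forall a, n * n <= a -> Defs.mem st' a = Defs.mem st a].
suff [_ copied _] : I (n * n) (run (LFor 7 (LFor 8 (LSeq
    (LStore (Reg 15) (Cell (Add (Reg 2) (Reg 15)))) (LAssign 15 (Add (Reg 15) (Cst 1)))))) st0).
  apply: (@eq_from_nth _ 0); first by rewrite size_mkseq size_adj_seq.
  move=> a; rewrite size_mkseq => lt_a; rewrite nth_mkseq // copied //.
  have n0 : 0 < n by case: (n) lt_a.
  have lt1 : a %/ n < n by rewrite ltn_divLR.
  have lt2 : a %% n < n by rewrite ltn_mod.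
  rewrite (divn_eq a n).
  by rewrite (rep_H R (Ordinal lt1) (Ordinal lt2)) (nth_adj_seq _ (Ordinal lt1) (Ordinal lt2)).
pose I1 k := I (k * n).
suff: I1 (regs st0 0) (run (LFor 7 (LFor 8 (LSeq
    (LStore (Reg 15) (Cell (Add (Reg 2) (Reg 15)))) (LAssign 15 (Add (Reg 15) (Cst 1)))))) st0).
  by rewrite [regs _ _](base0 B).
have r0 : regs st0 0 = n := base0 B.
have r2 : regs st0 2 = n * n := base2 B.
apply: run_for_ind => //; rewrite r0 => k st1 lt_kn _ frame Ik.
have r01 : regs st1 0 = n by rewrite frame.
have r21 : regs st1 2 = n * n by rewrite frame.
suff: I (k * n + regs st1 0) (run (LFor 8 (LSeq
    (LStore (Reg 15) (Cell (Add (Reg 2) (Reg 15)))) (LAssign 15 (Add (Reg 15) (Cst 1))))) st1).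
  by rewrite r01 /I1 mulSn addnC.
pose I2 l := I (k * n + l); apply: (@run_for_ind I2) => //.
  by rewrite /I2 addn0.
rewrite r01 => l st2 lt_ln _ frame2 [r15 low high].
have r22 : regs st2 2 = n * n by rewrite frame2.
have lt := cell_lt (Ordinal lt_kn) (Ordinal lt_ln); rewrite /= in lt.
rewrite /I2 addnS; split=> /=.
- by rewrite r15 addn1.
- move=> a; rewrite r15 r22 ltnS leq_eqVlt => /orP[/eqP->|lt_a].
    by rewrite eqxx high // leq_addr.
  by rewrite ltn_eqF // low.
- by move=> a le_a; rewrite r15 gtn_eqF ?high //; apply: leq_trans le_a.
Qed.
End Correctness.

Theorem theorem4 (R : realType) :
  exists (c : prog) (p : {poly nat}),
    forall (n : nat) (G : {set {set 'I_n}}) (s : 'I_n) (alpha beta : R)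
           (S : {set {set 'I_n}}),
      is_graph G -> (1 <= alpha)%R -> (0 <= beta)%R ->
      spanner alpha beta G S ->
      exists (t : nat) (st : state) (H : {set {set 'I_n}}),
        [/\ exec c (input_state G s S) t st,
            t <= (p.[n])%R,
            outputs st H,
            EABFS alpha beta G s H
          & #|H| <= #|S| + 3 * n].
Proof.
exists (compile eabfs), (time eabfs) => n G s alpha beta S _ a1 b0 spS.
(* That no loop body writes its counter and nothing writes register 0 is checked by computation. *)
have [t E le_t] := @compile_exec eabfs (input_state G s S) isT isT.
have [d [p [gd inv]]] := run_bfs (run_setup G s S) (bfs_inv_init _ _ _).
have tree := bfs_inv_tree inv.
have [H [gdH SH HG card aug]] := run_augment spS.1 tree gd.
exists t, (run eabfs (input_state G s S)), H; split.
- exact: E.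
- exact: le_t.
- exact: run_copy_out gdH.
- have sub := desc_subtrees tree (fun x => bfs_inv_dep x inv).
  apply: (swap_EABFS tree sub HG SH _ _ a1 b0 spS) => v v1.
    by have [] := aug v v1.
  by have [] := aug v v1.
- by apply: leq_trans card _; rewrite leq_add2l leq_mul2r orbT.
Qed.
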